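(* Let $G$ be a connected graph of order $n$ with girth $g$ and minimum degree $\delta \geq 2$. Let $u$ be a vertex of $G$ and let $N$ be the number of vertices of $G$ at distance less than or equal to $\left\lfloor \frac{g-1}{2} \right\rfloor - 1$ from $u$. Then $p_u(G) \leq n - N$.
   Context: All graphs are finite, undirected and simple. A $u,v$-geodesic is a shortest $u,v$-path. The girth is the length of a shortest cycle. The vertex $u$ itself is at distance $0$ from $u$ and is counted in $N$. For a vertex $u$ of $G$, a set $S \subseteq V(G)$ is a $u$-position set if for every $y \in S$ no vertex of $S \setminus \{y\}$ lies on any $u,y$-geodesic in $G$. The $u$-position number $p_u(G)$ is the maximum cardinality of a $u$-position set of $G$. *)

(* Defs.v *)
From mathcomp Require Import all_boot.
Set Implicit Arguments.
Unset Strict Implicit.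
Unset Printing Implicit Defensive.

Record sgraph := SGraph {
  vertex :> finType;
  adj : rel vertex;
  adj_sym : symmetric adj;
  adj_irrefl : irreflexive adj }.

Section Graph.
Variable G : sgraph.
Implicit Types (u v w y z : G) (S : {set G}) (p c : seq G).

Definition connected_graph : Prop := forall x y : G, connect (@adj G) x y.

Definition degree v : nat := #|[set w | adj v w]|.

(* Every degree is less than #|G|, so the default is never the minimum unless
   G has no vertex. *)
Definition min_degree : nat := \big[minn/#|G|]_(v : G) degree v.

(* A path from u to v is given by the sequence p of its vertices other than u;
   its length is size p. *)
Definition upath u v p : bool :=
  [&& path (@adj G) u p, uniq (u :: p) & last u p == v].

(* A path has at most #|G| - 1 edges; the value #|G| means that v is not
   reachable from u. *)
Definition dist u v : nat :=
  \big[minn/#|G|]_(k < #|G| | [exists p : k.-tuple G, upath u v p]) k.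

Definition graph_cycle c : bool := (2 < size c) && ucycleb (@adj G) c.

(* A cycle has at most #|G| vertices; the value #|G|.+1 means that G is
   acyclic. *)
Definition girth : nat :=
  \big[minn/#|G|.+1]_(k < #|G|.+1 | [exists c : k.-tuple G, graph_cycle c]) k.

Definition geodesic u v p : bool := upath u v p && (size p == dist u v).

(* Geodesics from u to y all have length dist u y, so quantifying over tuples
   of that size covers all of them. *)
Definition on_geodesic u y z : bool :=
  [exists p : (dist u y).-tuple G, geodesic u y p && (z \in u :: p)].

Definition position_set u S : bool :=
  [forall y in S, forall z in S :\ y, ~~ on_geodesic u y z].

Definition position_number u : nat :=
  \max_(S : {set G} | position_set u S) #|S|.

End Graph.

(* Main.v *)
Require Import Defs.
From mathcomp Require Import all_boot zify.

(** Put [r = (g - 1) %/ 2], so that [2 * r < g].  The ball of radius [r] around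
    [u] is a tree: a vertex with two neighbours no farther from [u] than itself,
    both at distance less than [r], would lie on a cycle of length at most
    [2 * r].  As degrees are at least 2, every vertex at distance less than [r]
    then has a child (a neighbour one step farther from [u]), and distinct
    vertices have distinct children.  Following children from a member of a
    position set [S] inside the ball of radius [r - 1] out to distance [r] gives
    a vertex outside both the ball and [S], and this assignment is injective
    since no member of [S] is an ancestor of another one. *)

(** * Minima over finite index types *)

Lemma bigminn_le (I : finType) (P : pred I) (F : I -> nat) x0 i :
  P i -> \big[minn/x0]_(j | P j) F j <= F i.
Proof.
move=> Pi; have: i \in index_enum I by rewrite mem_index_enum.
elim: (index_enum I) => //= j s IHs; rewrite inE big_cons.
case/predU1P=> [<-|/IHs le_s]; first by rewrite Pi geq_minl.
by case: ifP => // _; apply: leq_trans (geq_minr _ _) le_s.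
Qed.

Lemma bigminn_attained (I : finType) (P : pred I) (F : I -> nat) x0 :
  \big[minn/x0]_(j | P j) F j = x0 \/
  exists2 i, P i & \big[minn/x0]_(j | P j) F j = F i.
Proof.
apply: (big_ind (fun m => m = x0 \/ exists2 i, P i & m = F i)); first by left.
  by move=> m1 m2 H1 H2; case: (leqP m1 m2).
by move=> i Pi; right; exists i.
Qed.

(** * Distances and shortest paths *)

Section Distance.
Variables (G : sgraph) (u : G).
Implicit Types (v w x y z : G) (p q : seq G).

(** Here [p] may repeat vertices, whereas [dist] ranges over simple paths only, so [p] is first
    shortened to a simple path, which has fewer than [#|G|] edges. *)
Lemma dist_le_size p v :
  path (@adj G) u p -> last u p = v -> dist u v <= size p.
Proof.
case/shortenP=> p' p'P Up' sub_p' last_p'.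
have lt_p' : size p' < #|G|.
  by rewrite -[_.+1]/(size (u :: p')) -(card_uniqP Up') max_card.
apply: (leq_trans (n := size p')).
  apply: (bigminn_le _ _ _ _ (Ordinal lt_p')); apply/existsP.
  by exists (in_tuple p'); rewrite /upath p'P Up' last_p' eqxx.
by apply: uniq_leq_size sub_p'; case/andP: Up'.
Qed.

Lemma dist_adj v w p :
  path (@adj G) u p -> last u p = v -> size p = dist u v -> adj v w ->
  dist u w <= (dist u v).+1.
Proof.
move=> pP pv <- vw; rewrite -(size_rcons p w).
by apply: dist_le_size; rewrite ?last_rcons // rcons_path pP pv.
Qed.

Lemma shortest_path v : connect (@adj G) u v ->
  exists p, [/\ path (@adj G) u p, last u p = v & size p = dist u v].
Proof.
case/connectP=> p0 /shortenP[p pP Up _] ->; set w := last u p.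
have lt_p : size p < #|G|.
  by rewrite -[_.+1]/(size (u :: p)) -(card_uniqP Up) max_card.
case: (bigminn_attained _ (fun k : 'I_#|G| =>
    [exists p : k.-tuple G, upath u w p]) (@nat_of_ord _) #|G|) => [dG|].
  by have := dist_le_size _ _ pP (erefl w); rewrite /dist dG leqNgt lt_p.
case=> k /existsP[q /and3P[qP _ /eqP qw]] dk.
by exists q; split; rewrite // size_tuple -dk.
Qed.

(* A vertex preceding the end of a shortest path is strictly closer to [u]. *)
Lemma shortest_path_dist p v x :
  path (@adj G) u p -> last u p = v -> size p = dist u v ->
  x \in u :: p -> x != v -> dist u x < dist u v.
Proof.
move=> + + + /splitPl-xp; case: xp => p1 p2 p1x.
rewrite cat_path last_cat size_cat => /andP[p1P _] + <-.
case: p2 => [/= <-|y p2 _ _]; first by rewrite p1x eqxx.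
by rewrite /= addnS ltnS (leq_trans (dist_le_size _ _ p1P p1x)) ?leq_addr.
Qed.

Lemma on_geodesic_cat x y p q :
  path (@adj G) u p -> last u p = x ->
  path (@adj G) x q -> last x q = y ->
  dist u y = size p + size q -> on_geodesic u y x.
Proof.
move=> pP px qP qy dy.
have pqP : path (@adj G) u (p ++ q) by rewrite cat_path pP px.
have pqy : last u (p ++ q) = y by rewrite last_cat px.
(* Shortening the walk to a simple path cannot drop a vertex, as its length is already
   [dist u y]. *)
have Upq : uniq (u :: p ++ q).
  case/shortenP: (pqP) pqy => s sP Us s_sub sy.
  apply: (leq_size_uniq Us); last first.
    by rewrite /= ltnS size_cat -dy; apply: dist_le_size.
  by move=> z; rewrite !inE => /predU1P[->|/s_sub->]; rewrite ?eqxx ?orbT.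
have sz : size (p ++ q) == dist u y by rewrite size_cat dy.
apply/existsP; exists (Tuple sz).
rewrite /geodesic /upath /= pqP pqy eqxx sz andbT /=.
by move: Upq => /= ->; rewrite -cat_cons mem_cat -px mem_last.
Qed.

End Distance.

(** * Girth and short cycles *)

Lemma girth_le (G : sgraph) (c : seq G) : graph_cycle c -> girth G <= size c.
Proof.
move=> cC; have /and3P[_ _ Uc] := cC.
have lt_c : size c < #|G|.+1 by rewrite ltnS -(card_uniqP Uc) max_card.
apply: (bigminn_le _ _ _ _ (Ordinal lt_c)); apply/existsP.
by exists (in_tuple c).
Qed.

Lemma girth_gt2 (G : sgraph) : 2 <= #|G| -> 2 < girth G.
Proof.
move=> G2.
case: (bigminn_attained _ (fun k : 'I_#|G|.+1 =>
    [exists c : k.-tuple G, graph_cycle c]) (@nat_of_ord _) #|G|.+1).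
  by rewrite /girth => ->.
case=> k /existsP[c /andP[c2 _]]; rewrite /girth => ->.
by rewrite size_tuple in c2.
Qed.

Lemma min_degree_le (G : sgraph) (v : G) : min_degree G <= degree v.
Proof. exact: bigminn_le. Qed.

(* The shortest paths from [u] to [w1] and [w2] avoid [v], so together they
   contain a path from [w1] to [w2] that closes up to a cycle through [v]. *)
Lemma girth_le_two_parents (G : sgraph) (u v w1 w2 : G) :
  connected_graph G -> w1 != w2 -> adj v w1 -> adj v w2 ->
  dist u w1 <= dist u v -> dist u w2 <= dist u v ->
  girth G <= dist u w1 + dist u w2 + 2.
Proof.
move=> conG w12 vw1 vw2 d1 d2.
have neq w : adj v w -> v != w.
  by apply: contraTneq => <-; rewrite adj_irrefl.
have avoid w p : path (@adj G) u p -> last u p = w -> size p = dist u w ->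
    adj v w -> dist u w <= dist u v -> v \notin u :: p.
  move=> pP pw sp vw dw; apply/negP => vp.
  have := shortest_path_dist _ _ _ _ _ pP pw sp vp (neq _ vw).
  by rewrite ltnNge dw.
have [p1 [p1P p1w sp1]] := shortest_path _ u w1 (conG u w1).
have [p2 [p2P p2w sp2]] := shortest_path _ u w2 (conG u w2).
have vp1 := avoid _ _ p1P p1w sp1 vw1 d1.
have vp2 := avoid _ _ p2P p2w sp2 vw2 d2.
(* [q1] runs along [p1] backwards, from [w1] to [u]. *)
pose q1 := rev (belast u p1).
have q1P : path (@adj G) w1 q1.
  rewrite -p1w rev_path; rewrite -(eq_path (e := @adj G)) // => x y.
  exact: adj_sym.
have q1u : last w1 q1 = u.
  by rewrite /q1; case: (p1) p1w => //= x s _; rewrite rev_cons last_rcons.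
have qP : path (@adj G) w1 (q1 ++ p2) by rewrite cat_path q1P q1u.
have qw : last w1 (q1 ++ p2) = w2 by rewrite last_cat q1u.
have vq : v \notin q1 ++ p2.
  rewrite mem_cat mem_rev negb_or; move: vp2; rewrite inE negb_or => /andP[_ ->].
  by rewrite andbT; apply: contra vp1; apply: mem_belast.
have sq : size (q1 ++ p2) = dist u w1 + dist u w2.
  by rewrite size_cat size_rev size_belast sp1 sp2.
case/shortenP: qP qw => q qP Uq q_sub qw.
have szq : size q <= dist u w1 + dist u w2.
  by rewrite -sq; apply: uniq_leq_size q_sub; case/andP: Uq.
apply: (leq_trans (n := size [:: v, w1 & q])); last by rewrite /= addn2 !ltnS.
apply: girth_le; apply/and3P; split.
(* The cycle has at least three vertices: [q] is nonempty because [w1 != w2]. *)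
- by case: (q) qw w12 => //= ->; rewrite eqxx.
- by rewrite /= vw1 rcons_path qP qw adj_sym vw2.
- rewrite cons_uniq Uq andbT inE negb_or neq //=.
  by apply: contra vq => /q_sub.
Qed.

(** The default [v] is a dummy: under the girth and degree hypotheses below, the pick succeeds at
    every distance less than [r]. *)
Definition child {G : sgraph} (u v : G) : G :=
  odflt v [pick w | adj v w & dist u w == (dist u v).+1].

(** * Descending in the ball of radius [r] *)

Section Tree.
Variables (G : sgraph) (u : G) (r : nat).
Hypotheses (conG : connected_graph G) (r_girth : 2 * r < girth G).
Hypothesis deg2 : forall v : G, 2 <= degree v.
Implicit Types (v w x y : G).

(** Without a child, two neighbours of [v] would both be no farther than [v], giving a cycle of
    length at most [2 * dist u v + 2 <= 2 * r]. *)
Lemma childP v : dist u v < r ->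
  adj v (child u v) /\ dist u (child u v) = (dist u v).+1.
Proof.
move=> vr; rewrite /child; case: pickP => [w /andP[vw /eqP //]|none].
have closer w : adj v w -> dist u w <= dist u v.
  move=> vw; have [p [pP pv sp]] := shortest_path _ u v (conG u v).
  have := dist_adj _ _ _ _ _ pP pv sp vw.
  by rewrite leq_eqVlt ltnS; have := none w; rewrite /= vw /= => ->.
have /card_gt1P[w1 [w2 []]] := deg2 v; rewrite !inE => vw1 vw2 w12.
have := girth_le_two_parents _ u _ _ _ conG w12 vw1 vw2
  (closer _ vw1) (closer _ vw2).
have := closer _ vw1; have := closer _ vw2; lia.
Qed.

(** Otherwise the common child has two parents at the same distance below [r], and again a cycle of
    length at most [2 * r] appears. *)
Lemma child_inj v w : dist u v < r -> dist u w < r ->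
  child u v = child u w -> v = w.
Proof.
move=> vr wr eq_c; have [va vd] := childP _ vr; have [wa wd] := childP _ wr.
apply/eqP; apply: contraLR r_girth => vw.
rewrite adj_sym in va; rewrite adj_sym -eq_c in wa; rewrite -eq_c in wd.
have := girth_le_two_parents _ u _ _ _ conG vw va wa; lia.
Qed.

Lemma dist_iter_child v k :
  dist u v + k <= r -> dist u (iter k (child u) v) = dist u v + k.
Proof.
elim: k => [|k IHk] vk; first by rewrite addn0.
have IH := IHk ltac:(lia).
by have [|_ /= ->] := childP (iter k (child u) v); lia.
Qed.

Lemma path_iter_child v k : dist u v + k <= r ->
  exists q, [/\ path (@adj G) v q, last v q = iter k (child u) v & size q = k].
Proof.
elim: k => [|k IHk] vk; first by exists [::].
have [|q [qP qv sq]] := IHk; first by lia.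
have [|ca _] := childP (iter k (child u) v); first by rewrite dist_iter_child; lia.
exists (rcons q (iter k.+1 (child u) v)).
by rewrite rcons_path last_rcons size_rcons qP qv sq.
Qed.

Lemma on_geodesic_iter_child v k :
  dist u v + k <= r -> on_geodesic u (iter k (child u) v) v.
Proof.
move=> vk; have [p [pP pv sp]] := shortest_path _ u v (conG u v).
have [q [qP qv sq]] := path_iter_child _ _ vk.
by apply: on_geodesic_cat pP pv qP qv _; rewrite dist_iter_child // sp sq.
Qed.

Lemma iter_child_inj v w k : dist u v + k <= r -> dist u w + k <= r ->
  iter k (child u) v = iter k (child u) w -> v = w.
Proof.
elim: k => [|k IHk] //= vk wk eq_c; apply: IHk; [lia | lia |].
by apply: child_inj eq_c; rewrite dist_iter_child; lia.
Qed.

(** * Counting a position set *)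

Variable S : {set G}.
Hypothesis posS : position_set u S.

Lemma position_set_on_geodesic x y :
  x \in S -> y \in S -> on_geodesic u y x -> x = y.
Proof.
move=> xS yS xy; apply/eqP; apply: contraLR xy => neq_xy.
by have /forall_inP/(_ y yS)/forall_inP := posS; apply; rewrite !inE neq_xy.
Qed.

Lemma iter_child_boundary_inj : {in [set x in S | dist u x < r] &,
  injective (fun x => iter (r - dist u x) (child u) x)}.
Proof.
move=> x y; wlog le_xy : x y / dist u x <= dist u y.
  move=> th xB yB; case/orP: (leq_total (dist u x) (dist u y)) => le_xy.
    exact: th.
  by move/esym/th => <-.
rewrite !inE => /andP[xS xr] /andP[yS yr] /=.
(* Cancelling the last [r - dist u y] steps shows that [y] is a descendant of [x], so [x] lies on a
   geodesic from [u] to [y]. *)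
have -> : r - dist u x = (r - dist u y) + (dist u y - dist u x) by lia.
rewrite iterD => /iter_child_inj-eq_y.
have {}eq_y : iter (dist u y - dist u x) (child u) x = y.
  by apply: eq_y; rewrite ?dist_iter_child; lia.
apply: position_set_on_geodesic => //.
by rewrite -{1}eq_y; apply: on_geodesic_iter_child; lia.
Qed.

Lemma card_position_set : #|S| <= #|[set x | r <= dist u x]|.
Proof.
(* Members of [S] at distance at least [r] count for themselves; the others are sent to vertices
   outside [S] at distance exactly [r]. *)
rewrite -(cardsID [set x | dist u x < r] S).
rewrite -[X in _ <= X](cardsID S) addnC.
apply: leq_add.
  by apply/subset_leq_card/subsetP=> x; rewrite !inE -leqNgt andbC.
have -> : S :&: [set x | dist u x < r] = [set x in S | dist u x < r].
  by apply/setP => x; rewrite !inE.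
rewrite -(card_in_imset iter_child_boundary_inj); apply/subset_leq_card/subsetP=> y /imsetP[x].
rewrite inE => /andP[xS xr] ->.
have xk : dist u x + (r - dist u x) <= r by lia.
have dr : dist u (iter (r - dist u x) (child u) x) = r.
  by rewrite dist_iter_child; lia.
rewrite !inE dr leqnn andbT; apply/negP => fS.
(* An endpoint in [S] would have to equal its ancestor [x], yet their distances are [r] and less
   than [r]. *)
have := position_set_on_geodesic _ _ xS fS (on_geodesic_iter_child _ _ xk).
by move=> eq_x; rewrite -eq_x in dr; lia.
Qed.

End Tree.

Theorem theorem3p7 (G : sgraph) (n g delta N : nat) (u : G)
  (G_connected : connected_graph G)
  (order_G : #|G| = n)
  (girth_G : girth G = g)
  (min_degree_G : min_degree G = delta)
  (delta_ge2 : 2 <= delta)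
  (card_N : #|[set v : G | dist u v <= (g - 1) %/ 2 - 1]| = N) :
  position_number u <= n - N.
Proof.
have deg2 (v : G) : 2 <= degree v.
  by apply: (leq_trans _ (min_degree_le G v)); rewrite min_degree_G.
have g3 : 2 < g.
  by rewrite -girth_G girth_gt2 // (leq_trans (deg2 u)) ?max_card.
set r := (g - 1) %/ 2 in card_N.
have r_girth : 2 * r < girth G by rewrite girth_G /r; lia.
(* Since [r] is positive, the truncated [r - 1] is a true predecessor, so the vertices outside the
   ball are those at distance at least [r]. *)
have r_gt0 : 0 < r by rewrite /r; lia.
apply/bigmax_leqP => S posS.
apply: leq_trans (card_position_set _ _ _ G_connected r_girth deg2 _ posS) _.
rewrite -order_G -card_N -cardsT -cardsDS ?subsetT //.
by apply/subset_leq_card/subsetP=> x; rewrite !inE -ltnNge; lia.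
Qed.
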